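(* Let $L$ be a differential vector space over a field $\mathbf F$ with differential operator $\partial$, let $Q$ be a set of seminorms on $L$, and let $r: L_{\omega Q}\to L^\omega$ be a uniform section of the bundle $(L^\omega,\pi_Q,L_{\omega Q})$. Then for any element $F$ of the hyperspace $L_{\omega Q}$ and any real number $c$, $$\frac{\partial}{\partial r}(c\cdot F)=c\cdot\left(\frac{\partial}{\partial r}F\right).$$
   Context: $\mathbf F$ is a field with an absolute value $|\cdot|$, containing the real numbers (e.g. $\mathbb R$ or $\mathbb C$), so that multiplication by a real number is defined in $L$, $L^\omega$ and $L_{\omega Q}$. A seminorm on $L$ is a map $q:L\to[0,\infty)$ with $q(ax)=|a|q(x)$ and $q(x+y)\le q(x)+q(y)$. $L^\omega$ is the vector space of all sequences $(f_i)_{i\in\omega}$ in $L$ ($i=1,2,3,\dots$) with coordinatewise operations. For $f=(f_i),g=(g_i)\in L^\omega$, $f\approx_Q g$ means $\lim_{i\to\infty}q(f_i-g_i)=0$ for every $q\in Q$; this is an equivalence relation. The hyperspace $L_{\omega Q}$ is the set of equivalence classes $\mathrm{Hs}_Q(f_i)_{i\in\omega}$, a vector space with $\mathrm{Hs}_Q(f_i)+\mathrm{Hs}_Q(g_i)=\mathrm{Hs}_Q(f_i+g_i)$ and $a\,\mathrm{Hs}_Q(f_i)=\mathrm{Hs}_Q(af_i)$. $\pi_Q:L^\omega\to L_{\omega Q}$ is the natural projection. $L$ is a differential vector space: it carries a partially defined multiplication and a linear map $\partial:L\to L$ such that $\partial(f\cdot g)=(\partial f)\cdot g+f\cdot(\partial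 g)$ whenever $f\cdot g$ is defined. $\partial$ is extended to $L^\omega$ by $\partial(f_i)_{i\in\omega}=(\partial f_i)_{i\in\omega}$. A section is a map $r:L_{\omega Q}\to L^\omega$ (no linearity or continuity required) with $\pi_Q\circ r=\mathrm{id}$. It is uniform if $r(ax)=a\,r(x)$ for all $x\in L_{\omega Q}$ and $a\in\mathbf F$. The sectional derivative is the map $\frac{\partial}{\partial r}:L_{\omega Q}\to L_{\omega Q}$, $\frac{\partial}{\partial r}F=\pi_Q(\partial(r(F)))$. *)

(* Defs.v *)
From HB Require Import structures.
From mathcomp Require Import all_boot all_order all_algebra.
From mathcomp Require Import all_classical all_reals.
From mathcomp Require Import topology normedtype sequences.

Set Implicit Arguments.
Unset Strict Implicit.
Unset Printing Implicit Defensive.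

Import Order.TTheory GRing.Theory Num.Theory.
Import numFieldNormedType.Exports.

Local Open Scope classical_set_scope.
Local Open Scope ring_scope.
Local Open Scope quotient_scope.

Record absoluteValue (R : realType) (F : fieldType) := AbsoluteValue {
  absv :> F -> R;
  absv_ge0 : forall a, 0 <= absv a;
  absv_eq0 : forall a, absv a = 0 <-> a = 0;
  absvM : forall a b, absv (a * b) = absv a * absv b;
  ler_absvD : forall a b, absv (a + b) <= absv a + absv b
}.

Record seminorm (R : realType) (F : fieldType) (abs : absoluteValue R F)
    (L : lmodType F) := Seminorm {
  semin :> L -> R;
  semin_ge0 : forall x, 0 <= semin x;
  seminZ : forall a x, semin (a *: x) = abs a * semin x;
  ler_seminD : forall x y, semin (x + y) <= semin x + semin y
}.

(* [pmul f g = None] means that the product of [f] and [g] is undefined.  The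
   Leibniz rule includes that both products on its right-hand side are defined
   whenever the one on the left is. *)
Record differential (F : fieldType) (L : lmodType F) := Differential {
  pmul : L -> L -> option L;
  deriv :> {linear L -> L};
  derivM : forall f g h, pmul f g = Some h ->
    exists u v, [/\ pmul (deriv f) g = Some u,
                    pmul f (deriv g) = Some v &
                    deriv h = u + v]
}.

Section Hyperspace.
Variables (R : realType) (F : fieldType) (abs : absoluteValue R F).
Variables (L : lmodType F) (Q : set (seminorm abs L)).
Implicit Types (f g h : nat -> L) (a : F).

(* Sequences are indexed from 0, so the term of index [i] is the [i.+1]-th. *)
Definition hequiv f g : Prop :=
  forall q : seminorm abs L, Q q -> (fun i => q (f i - g i)) @ \oo --> (0 : R).

Lemma semin0 (q : seminorm abs L) : q 0 = 0.
Proof.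
rewrite -(scale0r 0) seminZ.
by have /absv_eq0 -> := erefl (0 : F); rewrite mul0r.
Qed.

Lemma absvN1 : abs (-1) = 1.
Proof.
have abs1 : abs 1 = 1.
  have n0 : abs 1 != 0 by apply/eqP => /absv_eq0/eqP; rewrite oner_eq0.
  by apply: (mulfI n0); rewrite -absvM !mulr1.
have /eqP : abs (-1) ^+ 2 = 1 by rewrite expr2 -absvM mulrNN mulr1.
rewrite sqrf_eq1 => /orP[/eqP //|/eqP absN1].
by have := absv_ge0 abs (-1); rewrite absN1 oppr_ge0 ler10.
Qed.

Lemma seminN (q : seminorm abs L) x : q (- x) = q x.
Proof. by rewrite -scaleN1r seminZ absvN1 mul1r. Qed.

Lemma hequiv_refl f : hequiv f f.
Proof.
move=> q _; under eq_fun do rewrite subrr semin0.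
exact: cvg_cst.
Qed.

Lemma hequiv_sym f g : hequiv f g -> hequiv g f.
Proof.
move=> fg q /fg; apply: cvg_trans.
by under eq_fun do rewrite -opprB seminN.
Qed.

Lemma hequivD f f' g g' :
  hequiv f f' -> hequiv g g' -> hequiv (f + g) (f' + g').
Proof.
move=> ff gg q Qq.
have := cvgD (ff q Qq) (gg q Qq); rewrite addr0 => fg.
apply: squeeze_cvgr; [|exact: cvg_cst|exact: fg].
by apply: nearW => i /=; rewrite semin_ge0 !fctE opprD addrACA ler_seminD.
Qed.

Lemma hequivZ a f g : hequiv f g -> hequiv (a *: f) (a *: g).
Proof.
move=> fg q Qq.
have -> : (fun i => q ((a *: f) i - (a *: g) i)) =
    (fun i => abs a * q (f i - g i)).
  by apply/funext => i; rewrite -seminZ scalerBr.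
by rewrite -(mulr0 (abs a)); apply: cvgM; [exact: cvg_cst|exact: fg].
Qed.

Lemma hequiv_trans f g h : hequiv f g -> hequiv g h -> hequiv f h.
Proof.
move=> fg gh; move=> q Qq; have := hequivD fg gh Qq.
apply: cvg_trans; rewrite (_ : (fun i => q _) = (fun i => q (f i - h i))) //.
by apply/funext => i; rewrite !fctE [g i + h i]addrC opprD addrACA subrr addr0.
Qed.

Lemma hequiv_is_equiv : equiv_class_of (fun f g => `[< hequiv f g >]).
Proof.
split=> [f|f g|g f h].
- exact/asboolP/hequiv_refl.
- by apply/asboolP/asboolP; apply: hequiv_sym.
- by move=> /asboolP fg /asboolP gh; apply/asboolP/(hequiv_trans fg gh).
Qed.

Definition hequiv_equiv := EquivRelPack hequiv_is_equiv.
Canonical hequiv_equiv.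
Canonical hequiv_encModRel := defaultEncModRel hequiv_equiv.

Definition hyperspace := {eq_quot hequiv_equiv}.
HB.instance Definition _ := EqQuotient.on hyperspace.
HB.instance Definition _ := Choice.on hyperspace.

Definition Hs f : hyperspace := \pi_hyperspace f.

Lemma HsP f g : Hs f = Hs g <-> hequiv f g.
Proof. by split=> [/eqmodP/asboolP|fg]; [|exact/eqmodP/asboolP]. Qed.

Lemma reprHs (x : hyperspace) : Hs (repr x) = x.
Proof. exact: reprK. Qed.

Let add (x y : hyperspace) : hyperspace := Hs (repr x + repr y).
Let opp (x : hyperspace) : hyperspace := Hs (- repr x).
Let scale a (x : hyperspace) : hyperspace := Hs (a *: repr x).

Let addE f g : add (Hs f) (Hs g) = Hs (f + g).
Proof. by apply/HsP/hequivD; apply/HsP; rewrite reprHs. Qed.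

Let scaleE a f : scale a (Hs f) = Hs (a *: f).
Proof. by apply/HsP/hequivZ/HsP; rewrite reprHs. Qed.

Let oppE f : opp (Hs f) = Hs (- f).
Proof. by rewrite -scaleN1r -scaleE /scale scaleN1r. Qed.

Let addA : associative add.
Proof.
by move=> x y z; rewrite -[x]reprHs -[y]reprHs -[z]reprHs !addE addrA.
Qed.

Let addC : commutative add.
Proof. by move=> x y; rewrite -[x]reprHs -[y]reprHs !addE addrC. Qed.

Let add0 : left_id (Hs 0) add.
Proof. by move=> x; rewrite -[x]reprHs addE add0r. Qed.

Let addN : left_inverse (Hs 0) opp add.
Proof. by move=> x; rewrite -[x]reprHs oppE addE addNr. Qed.

HB.instance Definition _ :=
  GRing.isZmodule.Build hyperspace addA addC add0 addN.

Let scaleA a b x : scale a (scale b x) = scale (a * b) x.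
Proof. by rewrite -[x]reprHs !scaleE scalerA. Qed.

Let scale1 : left_id 1 scale.
Proof. by move=> x; rewrite -[x]reprHs scaleE scale1r. Qed.

Let scaleDr : right_distributive scale add.
Proof.
move=> a x y; rewrite -[x]reprHs -[y]reprHs.
by rewrite addE !scaleE addE scalerDr.
Qed.

Let scaleDl x a b : scale (a + b) x = add (scale a x) (scale b x).
Proof. by rewrite -[x]reprHs !scaleE addE scalerDl. Qed.

HB.instance Definition _ :=
  GRing.Zmodule_isLmodule.Build F hyperspace scaleA scale1 scaleDr
    scaleDl.

Lemma HsD f g : Hs f + Hs g = Hs (f + g).
Proof. exact: addE. Qed.

Lemma HsZ a f : a *: Hs f = Hs (a *: f).
Proof. exact: scaleE. Qed.

Definition is_section (r : hyperspace -> nat -> L) : Prop := cancel r Hs.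

Definition is_uniform (r : hyperspace -> nat -> L) : Prop :=
  forall a x, r (a *: x) = a *: r x.

Definition deriv_seq (d : differential L) f : nat -> L := fun i => d (f i).

Definition sectional_derivative (d : differential L)
    (r : hyperspace -> nat -> L) (x : hyperspace) : hyperspace :=
  Hs (deriv_seq d (r x)).

End Hyperspace.

(* Main.v *)
Require Import Defs.
From mathcomp Require Import all_boot all_order all_algebra.
From mathcomp Require Import all_classical all_reals.

Import GRing.Theory.
Local Open Scope ring_scope.

(** A scalar passes through [r] by uniformity, through [d] termwise by linearity, and through [Hs]
    by the definition of the quotient operations. The ring morphism [iota], injective between
    fields, embeds the reals in [F]. *)
Theorem theorem3p2 (R : realType) (F : fieldType) (abs : absoluteValue R F)
    (iota : {rmorphism R -> F}) (L : lmodType F) (d : differential L)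
    (Q : set (seminorm abs L)) (r : hyperspace Q -> nat -> L)
    (r_section : is_section r) (r_uniform : is_uniform r)
    (x : hyperspace Q) (c : R) :
  sectional_derivative d r (iota c *: x) =
  iota c *: sectional_derivative d r x.
Proof.
(* The representatives are equal as sequences, which is stronger than [hequiv], so no limit has to
   be taken. *)
rewrite /sectional_derivative r_uniform HsZ; congr Hs.
by apply/boolp.funext => i; rewrite /deriv_seq linearZ.
Qed.
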